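(* Let $\{X_i\}_{i\in I}$ be a collection of Banach spaces having property (K) (with $I$ an arbitrary index set). Then the $\ell^p$-sum $\left(\bigoplus_{i\in I}X_i\right)_{\ell^p}$ has property (K) for any $1<p<\infty$.
   Context: All linear spaces are real. Given a sequence $(x_n)$ in a linear space, a convex block subsequence of $(x_n)$ is a sequence $(y_k)$ of the form $y_k=\sum_{n\in I_k}a_n x_n$, where $(I_k)$ is a sequence of finite subsets of $\mathbb{N}$ with $\max(I_k)<\min(I_{k+1})$ and $(a_n)$ is a sequence of non-negative real numbers with $\sum_{n\in I_k}a_n=1$ for all $k\in\mathbb{N}$. For a Banach space $X$, the Mackey topology $\mu(X^*,X)$ on $X^*$ is the topology of uniform convergence on weakly compact subsets of $X$. A Banach space $X$ has property (K) if every $w^*$-convergent sequence in $X^*$ admits a convex block subsequence which is $\mu(X^*,X)$-convergent. *)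

(* Defs.v *)
From HB Require Import structures.
From mathcomp Require Import all_boot all_order all_algebra finmap ring lra.
From mathcomp Require Import all_classical all_reals all_analysis.

Set Implicit Arguments.
Unset Strict Implicit.
Unset Printing Implicit Defensive.
Import Order.TTheory GRing.Theory Num.Theory.
Import numFieldNormedType.Exports.

Local Open Scope classical_set_scope.
Local Open Scope ring_scope.

Section lp_sum.
Context {R : realType} {I : Type} (X : I -> completeNormedModType R) (p : R).
Hypothesis p1 : 1 <= p.

Implicit Types x y z : forall i, X i.

(* esum requires a choiceType; {classic I} is I with a classical choice
   structure, so the index set I can be arbitrary. *)
Definition lp_mass x : \bar R :=
  (\esum_(i in [set: {classic I}]) (`|x i| `^ p)%:E)%E.

Let p0 : 0 < p. Proof. exact: lt_le_trans p1. Qed.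

Let powRK (a : R) : 0 <= a -> (a `^ p) `^ p^-1 = a.
Proof. by move=> a0; rewrite -powRrM mulfV ?gt_eqF// powRr1. Qed.

Lemma lp_mass_ge0 x : (0 <= lp_mass x)%E.
Proof. by apply: esum_ge0 => i _; rewrite lee_fin powR_ge0. Qed.

Lemma lp_mass_leP x (c : R) :
  (lp_mass x <= c%:E)%E <->
  (forall J : {fset {classic I}}, \sum_(i <- J) `|x i| `^ p <= c).
Proof.
split=> [h J|h].
  rewrite -lee_fin (le_trans _ h)// esum_ge//; exists [set` J]; first by split.
  by rewrite fsbig_finite//= set_fsetK sumEFin.
apply: ge_ereal_sup => _ [J [Jfin _] <-].
by rewrite fsbig_finite//= sumEFin lee_fin.
Qed.

Lemma powR_convex2 (a b s t : R) : 0 < a -> 0 < b -> 0 <= s -> 0 <= t ->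
  (s + t) `^ p <=
  (a + b) `^ p * (a / (a + b) * (s / a) `^ p + b / (a + b) * (t / b) `^ p).
Proof.
move=> a0 b0 s0 t0.
have ab0 : 0 < a + b by rewrite addr_gt0.
have w0 : 0 <= a / (a + b) by rewrite divr_ge0// ltW.
have w1 : a / (a + b) <= 1 by rewrite ler_pdivrMr// mul1r lerDl ltW.
have sE : s + t = (a + b) * (a / (a + b) * (s / a) + b / (a + b) * (t / b)).
  by field; rewrite !gt_eqF.
rewrite {1}sE powRM ?(ltW ab0)//; last first.
  by apply: addr_ge0; apply: mulr_ge0; apply: divr_ge0 => //; exact: ltW.
rewrite ler_wpM2l ?powR_ge0//.
have := @convex_powR R p p1 (Itv01 w0 w1) (s / a) (t / b).
have sa0 : 0 <= s / a by rewrite divr_ge0// ltW.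
have tb0 : 0 <= t / b by rewrite divr_ge0// ltW.
rewrite !inE/= !in_itv/= !andbT => /(_ sa0 tb0).
rewrite convRE [X in X `^ _ <= _]convRE/= /unstable.onem.
by have -> : 1 - a / (a + b) = b / (a + b) by field; rewrite gt_eqF.
Qed.

Lemma powR_sum_minkowski (J : Type) (r : seq J) (f g : J -> R) (a b : R) :
  0 < a -> 0 < b -> (forall i, 0 <= f i) -> (forall i, 0 <= g i) ->
  \sum_(i <- r) f i `^ p <= a `^ p -> \sum_(i <- r) g i `^ p <= b `^ p ->
  \sum_(i <- r) (f i + g i) `^ p <= (a + b) `^ p.
Proof.
move=> a0 b0 f0 g0 fa gb; have ab0 : 0 < a + b by rewrite addr_gt0.
apply: (@le_trans _ _ (\sum_(i <- r) ((a + b) `^ p *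
    (a / (a + b) * (f i / a) `^ p + b / (a + b) * (g i / b) `^ p)))).
  by apply: ler_sum => i _; exact: powR_convex2.
rewrite -mulr_sumr ler_piMr ?powR_ge0// big_split/= -!mulr_sumr.
have normalize (h : J -> R) c : 0 < c -> (forall i, 0 <= h i) ->
    \sum_(i <- r) h i `^ p <= c `^ p -> \sum_(i <- r) (h i / c) `^ p <= 1.
  move=> c0 h0 hc; under eq_bigr do rewrite powRM ?invr_ge0 ?(ltW c0)//.
  rewrite -mulr_suml -powR_inv1 ?(ltW c0)// powRAC powR_inv1 ?powR_ge0//.
  by rewrite ler_pdivrMr ?powR_gt0// mul1r.
have -> : 1 = a / (a + b) * 1 + b / (a + b) * 1.
  by field; rewrite gt_eqF.
by apply: lerD; apply: ler_wpM2l; do ?[exact: normalize]; rewrite divr_ge0// ltW.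
Qed.

Lemma lp_massD x y (a b : R) : 0 < a -> 0 < b ->
  (lp_mass x <= (a `^ p)%:E)%E -> (lp_mass y <= (b `^ p)%:E)%E ->
  (lp_mass (fun i => (x i + y i)%R) <= ((a + b) `^ p)%:E)%E.
Proof.
move=> a0 b0 /lp_mass_leP xa /lp_mass_leP yb; apply/lp_mass_leP => J.
apply: le_trans (powR_sum_minkowski a0 b0 _ _ (xa J) (yb J)) => //.
apply: ler_sum => i _; apply: ge0_ler_powR; rewrite ?nnegrE ?(ltW p0)//.
exact: ler_normD.
Qed.

Lemma lp_massZ (k : R) x :
  lp_mass (fun i => k *: x i) = ((`|k| `^ p)%:E * lp_mass x)%E.
Proof.
have le (c : R) y : (lp_mass (fun i => c *: y i) <=
    (`|c| `^ p)%:E * lp_mass y)%E.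
  apply: ge_ereal_sup => _ [J [Jfin _] <-].
  rewrite fsbig_finite//=; under eq_bigr do rewrite normrZ powRM// EFinM.
  rewrite -ge0_sume_distrr; last by move=> i _; rewrite lee_fin powR_ge0.
  rewrite lee_wpmul2l ?lee_fin ?powR_ge0// esum_ge//; exists J => //.
  by rewrite fsbig_finite.
apply/eqP; rewrite eq_le le/=.
have [->|k0] := eqVneq k 0.
  by rewrite normr0 powR0 ?gt_eqF// mul0e lp_mass_ge0.
have := le k^-1 (fun i => k *: x i).
have -> : (fun i => k^-1 *: (k *: x i)) = x.
  by apply: functional_extensionality_dep => i; rewrite scalerA mulVf// scale1r.
have kp : 0 < `|k| `^ p by rewrite powR_gt0// normr_gt0.
move=> /(@lee_wpmul2l _ (`|k| `^ p)%:E); rewrite lee_fin (ltW kp) => /(_ isT).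
rewrite muleA -EFinM normfV -powRM ?invr_ge0// divff ?normr_eq0//.
by rewrite powR1 mul1e.
Qed.

Lemma lp_mass0 : lp_mass (fun i => 0) = 0%E.
Proof. by apply: esum1 => i _; rewrite normr0 powR0 ?gt_eqF. Qed.

Lemma lp_mass_finP x :
  (lp_mass x < +oo)%E <-> exists2 a : R, 0 < a & (lp_mass x <= (a `^ p)%:E)%E.
Proof.
split=> [xoo|[a _ /le_lt_trans]]; last by apply; rewrite ltry.
have xfin : lp_mass x \is a fin_num by rewrite ge0_fin_numE// lp_mass_ge0.
exists (1 + fine (lp_mass x)); first by rewrite ltr_pwDl// fine_ge0// lp_mass_ge0.
rewrite -{1}(fineK xfin) lee_fin (@le_trans _ _ (1 + fine (lp_mass x)))//.
  by rewrite lerDr.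
by rewrite le1r_powR// lerDl fine_ge0// lp_mass_ge0.
Qed.

(* The Banach space of all families x with \sum_i `|x i| ^ p < +oo, the sum
   being the supremum of the finite partial sums.  The exponent hypothesis is a
   parameter of the type, so that the norm structure can be attached to it. *)
Record lp_sum (hp : 1 <= p) := LpSum {
  lp_fun :> forall i, X i ;
  lp_finite : (lp_mass lp_fun < +oo)%E }.

Local Notation E := (lp_sum p1).

Lemma lp_sumP (x y : E) : (forall i, x i = y i) -> x = y.
Proof.
case: x y => [x xoo] [y yoo] /= xy.
have exy : x = y by apply: functional_extensionality_dep.
by subst y; congr LpSum; exact: Prop_irrelevance.
Qed.

HB.instance Definition _ := gen_eqMixin E.
HB.instance Definition _ := gen_choiceMixin E.

Lemma lp_finite0 : (lp_mass (fun i => 0%R : X i) < +oo)%E.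
Proof. by rewrite lp_mass0 ltry. Qed.

Lemma lp_finiteD (x y : E) : (lp_mass (fun i => (x i + y i)%R) < +oo)%E.
Proof.
have [a a0 xa] := (lp_mass_finP x).1 (lp_finite x).
have [b b0 yb] := (lp_mass_finP y).1 (lp_finite y).
by apply/lp_mass_finP; exists (a + b); [exact: addr_gt0|exact: lp_massD].
Qed.

Lemma lp_finiteZ (k : R) (x : E) : (lp_mass (fun i => (k *: x i)%R) < +oo)%E.
Proof.
by rewrite lp_massZ lte_mul_pinfty ?lee_fin ?powR_ge0//; exact: lp_finite.
Qed.

Lemma lp_finiteN (x : E) : (lp_mass (fun i => (- x i)%R) < +oo)%E.
Proof.
have := lp_finiteZ (-1) x.
by under [X in lp_mass X]functional_extensionality_dep do rewrite scaleN1r.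
Qed.

Definition lp_zero : E := LpSum p1 lp_finite0.
Definition lp_add (x y : E) : E := LpSum p1 (lp_finiteD x y).
Definition lp_opp (x : E) : E := LpSum p1 (lp_finiteN x).
Definition lp_scale (k : R) (x : E) : E := LpSum p1 (lp_finiteZ k x).

Lemma lp_addA : associative lp_add.
Proof. by move=> x y z; apply: lp_sumP => i /=; rewrite addrA. Qed.
Lemma lp_addC : commutative lp_add.
Proof. by move=> x y; apply: lp_sumP => i /=; rewrite addrC. Qed.
Lemma lp_add0 : left_id lp_zero lp_add.
Proof. by move=> x; apply: lp_sumP => i /=; rewrite add0r. Qed.
Lemma lp_addN : left_inverse lp_zero lp_opp lp_add.
Proof. by move=> x; apply: lp_sumP => i /=; rewrite addNr. Qed.

HB.instance Definition _ :=
  GRing.isZmodule.Build E lp_addA lp_addC lp_add0 lp_addN.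

Lemma lp_scaleA (a b : R) (x : E) :
  lp_scale a (lp_scale b x) = lp_scale (a * b) x.
Proof. by apply: lp_sumP => i /=; rewrite scalerA. Qed.
Lemma lp_scale1 : left_id 1 lp_scale.
Proof. by move=> x; apply: lp_sumP => i /=; rewrite scale1r. Qed.
Lemma lp_scaleDr : right_distributive lp_scale +%R.
Proof. by move=> k x y; apply: lp_sumP => i /=; rewrite scalerDr. Qed.
Lemma lp_scaleDl (x : E) : {morph lp_scale^~ x : a b / a + b}.
Proof. by move=> a b; apply: lp_sumP => i /=; rewrite scalerDl. Qed.

HB.instance Definition _ := GRing.Zmodule_isLmodule.Build R E
  lp_scaleA lp_scale1 lp_scaleDr lp_scaleDl.

Definition lp_norm (x : E) : R := fine (lp_mass x) `^ p^-1.

Lemma lp_massE (x : E) : lp_mass x = (lp_norm x `^ p)%:E.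
Proof.
rewrite /lp_norm -powRrM mulVf ?gt_eqF// powRr1 ?fine_ge0 ?lp_mass_ge0//.
by rewrite fineK// ge0_fin_numE ?lp_mass_ge0//; exact: lp_finite.
Qed.

Lemma lp_norm_ge0 (x : E) : 0 <= lp_norm x.
Proof. exact: powR_ge0. Qed.

Lemma lp_norm_leP (x : E) (a : R) : 0 <= a ->
  (lp_mass x <= (a `^ p)%:E)%E <-> lp_norm x <= a.
Proof.
move=> a0; rewrite lp_massE lee_fin; split=> [|xa]; last first.
  by rewrite ge0_ler_powR ?nnegrE ?lp_norm_ge0// ltW.
move=> /(@ge0_ler_powR _ p^-1); rewrite !nnegrE !powR_ge0 invr_ge0 (ltW p0).
by move=> /(_ isT isT isT); rewrite !powRK// lp_norm_ge0.
Qed.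

Lemma lp_normD (x y : E) : lp_norm (x + y) <= lp_norm x + lp_norm y.
Proof.
apply/ler_addgt0Pr => e e0; have e20 : 0 < e / 2 by rewrite divr_gt0.
rewrite (splitr e) addrACA; have h (z : E) : 0 < lp_norm z + e / 2 by rewrite ltr_wpDl// lp_norm_ge0.
apply/lp_norm_leP; first by rewrite addr_ge0// ltW.
by apply: lp_massD => //; apply/lp_norm_leP; rewrite ?(ltW (h _))// lerDl ltW.
Qed.

Lemma lp_normZ (k : R) (x : E) : lp_norm (k *: x) = `|k| * lp_norm x.
Proof.
rewrite [LHS]/lp_norm lp_massZ lp_massE -EFinM/= powRM ?powR_ge0//.
by rewrite !powRK// lp_norm_ge0.
Qed.

Lemma lp_coord_le (x : E) i : `|x i| <= lp_norm x.
Proof.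
have /lp_mass_leP/(_ [fset (i : {classic I})]%fset) :
  (lp_mass x <= (lp_norm x `^ p)%:E)%E by rewrite lp_massE.
rewrite big_seq_fset1 => /(@ge0_ler_powR _ p^-1).
rewrite !nnegrE !powR_ge0 invr_ge0 (ltW p0) => /(_ isT isT isT).
by rewrite !powRK// lp_norm_ge0.
Qed.

Lemma lp_norm_eq0 (x : E) : lp_norm x = 0 -> x = 0.
Proof.
move=> x0; apply: lp_sumP => i; apply/eqP.
by rewrite -normr_le0 -x0 lp_coord_le.
Qed.

HB.instance Definition _ :=
  Lmodule_isNormed.Build R E lp_normD lp_normZ lp_norm_eq0.

Lemma lp_normE (x : E) : `|x| = fine (lp_mass x) `^ p^-1.
Proof. by []. Qed.

Lemma lp_complete (F : set_system E) : ProperFilter F -> cauchy F -> cvg F.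
Proof.
have e4E (c : R) : 0 < c -> c / 4 + c / 4 + c / 4 <= c by move=> c0; lra.
move=> FF /cauchyP Fc.
have lP i : {l : X i | (fun x : E => x i) @ F --> l}.
  apply: cid; apply/cvg_ex; apply: cauchy_cvg; apply/cauchyP => e e0.
  have [x Fx] := Fc e e0; exists (x i); apply: (@filterS _ F _ _ _ _ Fx) => y.
  rewrite -!ball_normE/= => xy.
  exact: le_lt_trans (lp_coord_le (x - y) i) xy.
pose l : forall i, X i := fun i => projT1 (lP i).
have near_l (x : E) (e : R) : 0 < e -> F (ball x e) ->
    (lp_mass (fun i => (x i - l i)%R) <= ((e + e) `^ p)%:E)%E.
  move=> e0 Fx; apply/lp_mass_leP => J.
  pose d := e / (#|` J|.+1)%:R.
  have d0 : 0 < d by rewrite divr_gt0.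
  have Fl : F (\bigcap_(i in [set` J]) [set y : E | `|l i - y i| < d]).
    apply: filter_bigI => i _.
    by have /cvgrPdist_lt/(_ _ d0) := projT2 (lP i).
  have [y [xy ly]] := filter_ex (filterI Fx Fl).
  apply: (@le_trans _ _ (\sum_(i <- J) (`|x i - y i| + `|y i - l i|) `^ p)).
    apply: ler_sum => i _.
    apply: ge0_ler_powR; rewrite ?nnegrE ?(ltW p0)//.
    by rewrite -[x i - l i](subrKA (y i)) ler_normD.
  apply: powR_sum_minkowski => //.
    have /lp_mass_leP/(_ J) : (lp_mass (x - y)%R <= (e `^ p)%:E)%E.
      apply/lp_norm_leP; first exact: ltW.
      by move: xy; rewrite -ball_normE => /ltW.
    by [].
  apply: (@le_trans _ _ (\sum_(i <- J) d `^ p)).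
    rewrite big_seq [leRHS]big_seq; apply: ler_sum => i iJ.
    rewrite ge0_ler_powR ?nnegrE ?(ltW p0) ?(ltW d0)//.
    by rewrite distrC ltW//; exact: ly.
  rewrite big_const_seq count_predT iter_addr_0 -mulr_natr.
  rewrite powRM ?invr_ge0 ?(ltW e0)// -mulrA ler_piMr ?powR_ge0//.
  rewrite -powR_inv1// powRAC powR_inv1 ?powR_ge0//.
  rewrite mulrC ler_pdivrMr ?powR_gt0// mul1r.
  by rewrite (le_trans _ (le1r_powR _ p1)) ?ler_nat// ler1n.
have lfin : (lp_mass l < +oo)%E.
  have [x Fx] := Fc 1 ltr01.
  have zfin : (lp_mass (fun i => (x i - l i)%R) < +oo)%E.
    by apply/lp_mass_finP; exists (1 + 1); [exact: addr_gt0|exact: near_l].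
  pose z : E := LpSum p1 zfin.
  have := lp_finite (x - z).
  rewrite (_ : lp_fun (x - z) = l)//.
  by apply: functional_extensionality_dep => i /=; rewrite subKr.
apply/cvg_ex; exists (LpSum p1 lfin); apply/cvgrPdist_lt => e e0.
have e40 : 0 < e / 4 by rewrite divr_gt0.
have [x Fx] := Fc _ e40; near=> y.
have xl : `|x - LpSum p1 lfin| <= e / 4 + e / 4.
  apply/lp_norm_leP; first by rewrite addr_ge0// ltW.
  exact: near_l.
have xy : `|x - y| < e / 4.
  by near: y; apply: filterS Fx => y; rewrite -ball_normE.
rewrite distrC in xl; rewrite -(subrKA x); apply: le_lt_trans (ler_normD _ _) _.
exact: lt_le_trans (ler_ltD xl xy) (e4E _ e0).
Unshelve. all: by end_near. Qed.

HB.instance Definition _ := Uniform_isComplete.Build E lp_complete.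

End lp_sum.

Section dual.
Context {R : realType} (X : completeNormedModType R).

Definition is_dual : {pred X -> R^o} :=
  fun f => `[< linear f /\ continuous f >].

Lemma is_dual_submod_closed : submod_closed is_dual.
Proof.
split=> [|k f g].
  apply/asboolP; split=> [k x y|]; first by rewrite /= scaler0 addr0.
  exact: cst_continuous.
move=> /asboolP[fl fc] /asboolP[gl gc]; apply/asboolP; split=> [c x y|x].
  by rewrite !fctE fl gl !scalerDr !scalerA (mulrC k) addrACA.
by apply: cvgD; [apply: cvgZr; exact: fc|exact: gc].
Qed.

HB.instance Definition _ :=
  GRing.isSubmodClosed.Build R (X -> R^o) is_dual is_dual_submod_closed.

Record dual := Dual {
  dual_fun :> X -> R^o ;
  _ : dual_fun \in is_dual }.

HB.instance Definition _ := [isSub for dual_fun].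
HB.instance Definition _ := [Choice of dual by <:].
HB.instance Definition _ := [SubChoice_isSubLmodule of dual by <:].

Definition weak : topologicalType :=
  sup_topology (fun f : dual => Topological.on (initial_topology f)).

Definition weakly_compact (K : set X) := compact (K : set weak).

Definition weak_star : topologicalType :=
  initial_topology (dual_fun : dual -> {ptws X -> R^o}).

Definition mackey : topologicalType :=
  initial_topology (dual_fun : dual -> {family weakly_compact, X -> R^o}).

End dual.

(* The sets S k are nonempty since their weights sum to 1, so the third clause
   says that max (S k) < min (S k.+1). *)
Definition convex_block_subsequence {R : realType} {V : lmodType R}
    (x y : nat -> V) :=
  exists (S : nat -> {fset nat}) (a : nat -> R),
    [/\ forall n, 0 <= a n,
        forall k, \sum_(n <- S k) a n = 1,
        forall k m n, m \in S k -> n \in S k.+1 -> (m < n)%N &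
        forall k, y k = \sum_(n <- S k) a n *: x n].

Definition property_K {R : realType} (X : completeNormedModType R) :=
  forall f : nat -> dual X,
    (exists g : dual X, f @ \oo --> (g : weak_star X)) ->
  exists2 h : nat -> dual X, convex_block_subsequence f h &
    exists g : dual X, h @ \oo --> (g : mackey X).

(* Main.v *)
From HB Require Import structures.
Require Import Defs.
From mathcomp Require Import all_boot all_order all_algebra finmap ring lra.
From mathcomp Require Import all_classical all_reals all_analysis.

(** Subtracting the weak* limit, let (u_n) be weak*-null and bounded in the dual
    of the l^p-sum.  Call a sequence d a block of h when, for each r, almost all
    d_k lie in the convex hull of {h_n : n >= r}; this relation is transitive,
    admits diagonal sequences, and yields convex block subsequences after
    extraction.
    Since p > 1, (u_n) has blocks whose norm outside some finite set F of
    coordinates is at most a given e: past a finite set the u_n are almost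
    disjointly supported along a subsequence, and averages of disjoint pieces
    tend to zero in norm.  On the finitely many coordinates of F, property (K)
    of the X_i gives further blocks that are Mackey-null.  A diagonal block does
    this for all e = 1/(k+1).  On a weakly compact K, functionals of norm at
    most e are bounded by M e with M depending on K only (uniform boundedness in
    the dual, by a gliding hump, so that Hahn-Banach is not used); hence the
    diagonal block tends to zero uniformly on K. *)

Set Implicit Arguments.
Unset Strict Implicit.
Unset Printing Implicit Defensive.
Import Order.TTheory GRing.Theory Num.Theory.
Import numFieldNormedType.Exports.
Local Open Scope classical_set_scope.
Local Open Scope ring_scope.

(** * Algebra and boundedness of continuous functionals *)

Section dual_basics.
Context {R : realType} (X : completeNormedModType R).
Implicit Types (f g : dual X).

Lemma dual_linear f : linear f.
Proof. by case: f => f fd; have /asboolP[] := fd. Qed.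

Lemma dual_continuous f : continuous f.
Proof. by case: f => f fd; have /asboolP[] := fd. Qed.

HB.instance Definition _ f :=
  GRing.isLinear.Build R X R^o *:%R (f : X -> R^o) (@dual_linear f).

Lemma dualDE f g x : (f + g) x = f x + g x.
Proof. by rewrite -[LHS]/((\val (f + g)) x) raddfD. Qed.

Lemma dualNE f x : (- f) x = - f x.
Proof. by rewrite -[LHS]/((\val (- f)) x) raddfN. Qed.

Lemma dualBE f g x : (f - g) x = f x - g x.
Proof. by rewrite dualDE dualNE. Qed.

Lemma dual0E x : (0 : dual X) x = 0.
Proof. by rewrite -[LHS]/((\val 0) x) raddf0. Qed.

Lemma dualZE (a : R) f x : (a *: f) x = a * f x.
Proof. by rewrite -[LHS]/((\val (a *: f)) x) linearZ. Qed.

Lemma dual_sumE (T : Type) (r : seq T) (F : T -> dual X) x :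
  (\sum_(i <- r) F i) x = \sum_(i <- r) F i x.
Proof. by elim: r => [|i r IH]; rewrite ?big_nil ?dual0E// !big_cons dualDE IH. Qed.

Lemma dual_bounded f : exists2 C : R, 0 < C & forall x, `|f x| <= C * `|x|.
Proof.
have /linear_boundedP[M [_ Mf]] := continuous_linear_bounded 0 (@dual_continuous f 0).
exists (`|M| + 1); first by rewrite ltr_wpDl.
by move=> x; apply: Mf; rewrite (le_lt_trans (ler_norm _))// ltrDl.
Qed.

Lemma is_dual_bounded (f : X -> R^o) (C : R) :
  linear f -> (forall x, `|f x| <= C * `|x|) -> f \in is_dual (X := X).
Proof.
move=> lf fC; apply/asboolP; split => //.
pose F := HB.pack_for {linear X -> R^o} f (GRing.isLinear.Build _ _ _ _ f lf).
apply: (@bounded_linear_continuous _ _ _ F); apply/linear_boundedP.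
exists C; split; first exact: num_real.
by move=> r Cr x; rewrite (le_trans (fC x))// ler_wpM2r// ltW.
Qed.

End dual_basics.

(** * Convex hulls of tails and the block relation *)

Section convex_hull.
Context {R : realType} {V : lmodType R}.
Implicit Types (A Q : set V) (x y z u d h : nat -> V).

Definition is_convex Q := forall (t : R) v w,
  0 <= t <= 1 -> Q v -> Q w -> Q (t *: v + (1 - t) *: w).

(** As an intersection of convex sets, the hull transfers convex properties without any
    coefficients; [hull_tailP] recovers coefficients where blocks must be written out. *)
Definition hull A : set V :=
  [set v | forall Q, is_convex Q -> A `<=` Q -> Q v].

Lemma sub_hull A : A `<=` hull A.
Proof. by move=> v Av Q _; apply. Qed.

Lemma is_convex_hull A : is_convex (hull A).
Proof. by move=> t v w t01 Av Aw Q Qc AQ; exact: Qc t01 (Av _ Qc AQ) (Aw _ Qc AQ). Qed.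

Lemma hull_min A Q : is_convex Q -> A `<=` Q -> hull A `<=` Q.
Proof. by move=> Qc AQ v; apply. Qed.

Lemma is_convex_sum Q (I : eqType) (r : seq I) (a : I -> R) (v : I -> V) :
  is_convex Q -> (forall i, 0 <= a i) -> (forall i, i \in r -> Q (v i)) ->
  \sum_(i <- r) a i = 1 -> Q (\sum_(i <- r) a i *: v i).
Proof.
move=> Qc a0.
(* What remains of a convex combination after its first term no longer has total weight 1, so the
   induction runs over any positive total and divides by it. *)
suff H : (forall i, i \in r -> Q (v i)) -> 0 < \sum_(i <- r) a i ->
    Q ((\sum_(i <- r) a i)^-1 *: \sum_(i <- r) a i *: v i).
  by move=> Qv a1; have := H Qv; rewrite a1 invr1 scale1r; apply.
elim: r => [|i r IH] Qv; first by rewrite big_nil ltxx.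
rewrite !big_cons => s0.
have Qr j : j \in r -> Q (v j) by move=> jr; apply: Qv; rewrite inE jr orbT.
have Qi : Q (v i) by apply: Qv; rewrite inE eqxx.
set S := \sum_(j <- r) a j in s0 *; set W := \sum_(j <- r) _.
have : 0 <= S by apply: sumr_ge0 => j _; exact: a0.
rewrite le_eqVlt => /predU1P[S0|S0].
  have -> : W = 0.
    rewrite /W big_seq big1// => j jr.
    suff -> : a j = 0 by rewrite scale0r.
    apply/eqP; rewrite eq_le a0 andbT S0 /S (big_rem j)//= lerDl.
    by apply: sumr_ge0 => k _; exact: a0.
  by move: s0; rewrite -S0 !addr0 => s0; rewrite scalerA mulVf ?scale1r// gt_eqF.
have := Qc (a i / (a i + S)) _ _ _ Qi (IH Qr S0).
rewrite -/S -/W scalerA => /(_ _)/[!(scalerDr, scalerA)].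
have -> : (1 - a i / (a i + S)) / S = (a i + S)^-1.
  by field; rewrite !gt_eqF.
rewrite [a i / _]mulrC; apply.
by rewrite mulrC divr_ge0 ?(ltW s0)//= ler_pdivrMr// mul1r lerDl ltW.
Qed.

Definition tail h (r : nat) : set V := [set h n | n in [set n | (r <= n)%N]].

(** Combinations of this form make up a convex set containing the tail. The weights vanish outside
    the range so that two combinations can be summed over the longer of their ranges. *)
Lemma hull_tailP h r v : hull (tail h r) v -> exists N (w : nat -> R),
  [/\ forall n, 0 <= w n, forall n, ~~ (r <= n < N)%N -> w n = 0,
      \sum_(r <= n < N) w n = 1 & v = \sum_(r <= n < N) w n *: h n].
Proof.
pose Q v := exists N (w : nat -> R),
  [/\ forall n, 0 <= w n, forall n, ~~ (r <= n < N)%N -> w n = 0,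
      \sum_(r <= n < N) w n = 1 & v = \sum_(r <= n < N) w n *: h n].
have widen N N' (w : nat -> R) : (forall n, ~~ (r <= n < N)%N -> w n = 0) ->
    (N <= N')%N -> (\sum_(r <= n < N') w n = \sum_(r <= n < N) w n) *
    (\sum_(r <= n < N') w n *: h n = \sum_(r <= n < N) w n *: h n).
  move=> w0 NN'; split; rewrite [RHS](big_nat_widen _ _ _ _ _ NN') [RHS]big_mkcond;
    by apply: eq_big_nat => n /andP[rn nN] /=; case: ifPn => // ?;
       rewrite w0 ?scale0r// rn.
apply: (@hull_min _ Q); last first.
  move=> _ [n rn <-]; exists n.+1, (fun m => (m == n)%:R).
  split=> [m|m|| ]; first by rewrite ler0n.
  - by case: eqP => // ->; rewrite rn leqnn.
  - by rewrite big_nat_recr//= eqxx big_nat big1 ?add0r// => m /andP[_ /ltn_eqF->].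
  - rewrite big_nat_recr//= eqxx scale1r big_nat big1 ?add0r// => m /andP[_ /ltn_eqF->].
    by rewrite scale0r.
move=> t _ _ /andP[t0 t1] [N1 [w1 [w10 w1z w1s ->]]] [N2 [w2 [w20 w2z w2s ->]]].
have [e1 e1'] := widen _ _ _ w1z (leq_maxl N1 N2).
have [e2 e2'] := widen _ _ _ w2z (leq_maxr N1 N2).
exists (maxn N1 N2), (fun n => t * w1 n + (1 - t) * w2 n); split=> [n|n nr||].
- by rewrite addr_ge0 ?mulr_ge0// subr_ge0.
- rewrite w1z ?w2z ?mulr0 ?addr0//; apply: contra nr => /andP[-> /= nN];
  by rewrite leq_max nN ?orbT.
- by rewrite big_split/= -!mulr_sumr e1 e2 w1s w2s !mulr1 subrKC.
- rewrite -e1' -e2' !scaler_sumr -big_split/=; apply: eq_bigr => n _.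
  by rewrite [RHS]scalerDl !scalerA.
Qed.

(** No order or disjointness of blocks is recorded, so transitivity and diagonal choices need no
    bookkeeping; [convex_block_of] restores successive blocks by selecting terms. *)
Definition block_of d h := forall r, \forall k \near \oo, hull (tail h r) (d k).

Lemma block_of_refl h : block_of h h.
Proof. by move=> r; exists r => // n rn; apply: sub_hull; exists n. Qed.

Lemma block_of_shift h N : block_of (fun n => h (n + N)%N) h.
Proof.
move=> r; exists r => // k /= rk; apply: sub_hull; exists (k + N)%N => //=.
by rewrite (leq_trans rk)// leq_addr.
Qed.

Lemma block_of_hull d h :
  (forall k, hull (tail h k) (d k)) -> block_of d h.
Proof.
move=> hd r; exists r => // k /= rk; apply: hull_min (hd k).
  exact: is_convex_hull.
by move=> _ [n /= kn <-]; apply: sub_hull; exists n => //=; exact: leq_trans kn.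
Qed.

(** A convex set containing a tail of [h] contains its hull, hence almost all of [d]. Every estimate
    passes to blocks this way. *)
Lemma block_of_near Q d h : is_convex Q -> block_of d h ->
  (\forall n \near \oo, Q (h n)) -> \forall k \near \oo, Q (d k).
Proof.
move=> Qc dh [r _ rQ]; apply: filterS (dh r) => k; apply: hull_min => //.
by move=> _ [n rn <-]; exact: rQ.
Qed.

Lemma block_of_trans d h u : block_of d h -> block_of h u -> block_of d u.
Proof. by move=> dh hu r; apply: block_of_near dh (hu r); exact: is_convex_hull. Qed.

(** Iterating the second hypothesis gives sequences [H k], each a block of the previous one. The
    term [d k] is taken from [H k] inside the hulls of the tails from [k] of all of [H 0], ...,
    [H k], so [d] is a block of every [H j] and inherits [P k] from [H k.+1]. *)
Lemma block_of_diag (P : nat -> (nat -> V) -> Prop) u :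
  (forall k h d, P k h -> block_of d h -> P k d) ->
  (forall k h, block_of h u -> exists2 d, block_of d h & P k d) ->
  exists2 d, block_of d u & forall k, P k d.
Proof.
move=> Pher Pex.
(* The implication makes the choice total: where [kh.2] is not a block of [u], any value will do. *)
have /choice[F FP] : forall kh : nat * (nat -> V), exists d, block_of kh.2 u ->
    block_of d kh.2 /\ P kh.1 d.
  move=> [k h]; have [hu|nhu] := pselect (block_of h u); last by exists h.
  by have [d] := Pex k h hu; exists d.
pose H := fix H k := if k is k'.+1 then F (k', H k') else u.
have Hu k : block_of (H k) u.
  elim: k => [|k IH]; first exact: block_of_refl.
  by have [Hd _] := FP (k, H k) IH; exact: block_of_trans Hd IH.
have HS k : block_of (H k.+1) (H k) /\ P k (H k.+1) by exact: FP (k, H k) (Hu k).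
have HH j k : (j <= k)%N -> block_of (H k) (H j).
  move=> /subnK <-; elim: (k - j)%N => [|m IH]; first exact: block_of_refl.
  by have [Hd _] := HS (m + j)%N; exact: block_of_trans Hd IH.
have /choice[phi phiP] k : exists n, forall j : 'I_k.+1, hull (tail (H j) k) (H k n).
  suff : \forall n \near \oo, forall j : 'I_k.+1, hull (tail (H j) k) (H k n).
    exact: filter_ex.
  by apply: filter_forall => j; apply: HH; rewrite -ltnS.
pose d k := H k (phi k).
have dH j : block_of d (H j).
  move=> r; exists (maxn r j) => // k /=; rewrite geq_max => /andP[rk jk].
  have jk' : (j < k.+1)%N by rewrite ltnS.
  apply: hull_min (phiP k (Ordinal jk')); first exact: is_convex_hull.
  by move=> _ [n kn <-]; apply: sub_hull; exists n => //=; exact: leq_trans kn.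
exists d; first exact: (dH 0%N).
by move=> k; apply: Pher (dH k.+1); have [] := HS k.
Qed.

Lemma block_of_convex_block u d : convex_block_subsequence u d -> block_of d u.
Proof.
move=> [S [a [a0 a1 Slt dE]]] r.
(* Each block is nonempty, because its weights sum to 1, and lies strictly beyond the one before;
   hence block [k] starts at [k] or later. *)
have Sk k n : n \in S k -> (k <= n)%N.
  elim: k n => // k IH n nS.
  have [m mS] : exists m, m \in S k.
    apply/fset0Pn; apply/eqP => Sk0; have := a1 k.
    by rewrite Sk0 big_seq_fset0 => /esym/eqP; rewrite oner_eq0.
  by apply: leq_ltn_trans (IH _ mS) _; exact: Slt nS.
exists r => // k /= rk; rewrite dE; apply: is_convex_sum => //.
  exact: is_convex_hull.
by move=> n /Sk kn; apply: sub_hull; exists n => //=; exact: leq_trans kn.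
Qed.

(** Greedy choice: the next term of [d] is taken so late that it is a combination of terms of [u]
    past the end of the block just used. *)
Lemma convex_block_of u d : block_of d u ->
  exists2 phi : nat -> nat, (forall k, k <= phi k)%N &
  convex_block_subsequence u (d \o phi).
Proof.
move=> du.
have /choice[F FP] r : exists F : nat * nat * (nat -> R),
   [/\ (r <= F.1.1)%N, (r < F.1.2)%N, forall n, 0 <= F.2 n &
    [/\ forall n, ~~ (r <= n < F.1.2)%N -> F.2 n = 0,
       \sum_(r <= n < F.1.2) F.2 n = 1 &
       d F.1.1 = \sum_(r <= n < F.1.2) F.2 n *: u n]].
  have [k [/= rk]] := filter_ex (filterI (nbhs_infty_ge r) (du r)).
  move=> /hull_tailP[N [w [w0 wz ws dE]]]; exists (k, N, w); split => //=.
  rewrite ltnNge; apply/negP => Nr; move: ws; rewrite big_geq// => /esym/eqP.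
  by rewrite oner_eq0.
pose rr := fix rr k := if k is k'.+1 then (F (rr k')).1.2 else 0%N.
have rrS k : (rr k < rr k.+1)%N by have [] := FP (rr k).
have rr_le j k : (j <= k)%N -> (rr j <= rr k)%N.
  move=> /subnK <-; elim: (k - j)%N => // m /leq_trans; apply.
  by rewrite addSn ltnW.
have rr_ge k : (k <= rr k)%N by elim: k => // k IH; exact: leq_ltn_trans (rrS k).
pose S k := [fset n in index_iota (rr k) (rr k.+1)]%fset.
(* A single weight sequence must serve all blocks. The block containing [n] has index at most [n],
   since [k <= rr k], and all other summands vanish at [n]. *)
pose a n := \sum_(j < n.+1) (F (rr j)).2 n.
have SE (W : lmodType R) k (f : nat -> W) :
    \sum_(n <- S k) f n = \sum_(rr k <= n < rr k.+1) f n.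
  apply: perm_big; apply: uniq_perm; rewrite ?fset_uniq ?iota_uniq//.
  by move=> n; rewrite in_fset/=.
have aE k n : (rr k <= n < rr k.+1)%N -> a n = (F (rr k)).2 n.
  move=> /andP[kn nk]; have kn' : (k < n.+1)%N by rewrite ltnS (leq_trans _ kn).
  rewrite /a (bigD1 (Ordinal kn'))//= big1 ?addr0// => j jk.
  have [_ _ _ [-> //]] := FP (rr j); rewrite -/(rr j.+1) negb_and -ltnNge -leqNgt.
  have [jk'|kj] := ltnP j k.
    by rewrite (leq_trans _ kn) ?orbT// rr_le.
  rewrite (leq_trans nk)// rr_le// ltn_neqAle kj andbT.
  by apply: contra jk => /eqP kj'; apply/eqP/val_inj.
exists (fun k => (F (rr k)).1.1).
  by move=> k; have [rk _ _ _] := FP (rr k); exact: leq_trans rk.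
exists S, a; split=> [n|k|k m n|k].
- by apply: sumr_ge0 => j _; have [] := FP (rr j).
- rewrite (SE R^o) (eq_big_nat _ _ (aE k)).
  by have [_ _ _ []] := FP (rr k).
- rewrite !in_fset/= !mem_index_iota => /andP[_ mk] /andP[kn _].
  exact: leq_trans kn.
- rewrite SE /=.
  have [_ _ _ [_ _ ->]] := FP (rr k).
  by apply: eq_big_nat => n /aE ->.
Qed.

End convex_hull.

(** * Convergence in the weak, weak* and Mackey topologies *)

Lemma cvg_initialP (S : choiceType) (T : topologicalType) (f : S -> T)
    (F : set_system S) (s : S) : Filter F ->
  F --> (s : initial_topology f) <-> f @ F --> f s.
Proof.
move=> FF; split=> [Fs|fFs].
  by apply: cvg_comp Fs _; exact: initial_continuous.
move=> A; rewrite nbhsE => -[_ [[C oC <-] /= Cfs] CA].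
by apply: filterS CA _; apply: fFs; exact: open_nbhs_nbhs.
Qed.

Section weak_topologies.
Context {R : realType} (X : completeNormedModType R).

Lemma weak_star_cvgP (f : nat -> dual X) (g : dual X) :
  f @ \oo --> (g : weak_star X) <-> forall x, f n x @[n --> \oo] --> g x.
Proof.
apply: (iff_trans (cvg_initialP _ _ _)).
exact: pointwise_cvgP.
Qed.

Lemma mackey_cvgP (f : nat -> dual X) (g : dual X) :
  f @ \oo --> (g : mackey X) <-> forall K, weakly_compact K ->
    forall e : R, 0 < e -> \forall n \near \oo, forall x, K x -> `|g x - f n x| < e.
Proof.
apply: (iff_trans (cvg_initialP _ _ _)).
apply: (iff_trans (fam_cvgP _ _ _)).
split=> [fg K Kc e e0|fg K Kc].
  apply: (fg K Kc [set h : X -> R^o | forall x, K x -> `|g x - h x| < e]).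
  apply/uniform_nbhs.
  exists [set xy : R^o * R^o | ball xy.1 e xy.2]; split.
    by rewrite -entourage_ballE; exists e.
  by move=> h /= Kh y /Kh; rewrite -ball_normE.
move=> A /uniform_nbhs[E [entE EA]].
have := entE; rewrite -entourage_ballE => -[e /= e0 eE].
apply: filterS (fg _ Kc _ e0) => n Kn; apply: EA => y Ky.
by apply: eE; rewrite /= -ball_normE; exact: Kn.
Qed.

Lemma weak_cvgP (F : set_system X) (x : X) : Filter F ->
  F --> (x : weak X) <-> forall f : dual X, f @ F --> f x.
Proof.
move=> FF; split=> [/cvg_sup Fx f|Fx]; first exact/cvg_initialP/Fx.
by apply/cvg_sup => f; apply/cvg_initialP; exact: Fx.
Qed.

Lemma dual_weak_continuous (f : dual X) : continuous (f : weak X -> R^o).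
Proof.
move=> x; have /weak_cvgP : (nbhs (x : weak X)) --> (x : weak X) by exact: cvg_id.
exact.
Qed.

Lemma weakly_compact_bounded (K : set X) (f : dual X) :
  weakly_compact K -> exists M : R, forall x, K x -> `|f x| <= M.
Proof.
move=> Kc.
have /compact_bounded[M [_ fM]] : compact ((f : weak X -> R^o) @` K).
  apply: (@continuous_compact (weak X) R^o f) => //; apply: continuous_subspaceT.
  exact: dual_weak_continuous.
exists (M + 1) => x Kx; apply: (fM (M + 1)); first by rewrite ltrDl.
by exists x.
Qed.

Lemma weakly_compact1 (x : X) : weakly_compact [set x].
Proof. exact: compact_set1. Qed.

Lemma mackey_weak_star (f : nat -> dual X) (g : dual X) :
  f @ \oo --> (g : mackey X) -> f @ \oo --> (g : weak_star X).
Proof.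
move=> /mackey_cvgP fg; apply/weak_star_cvgP => x; apply/cvgrPdist_lt => e e0.
have [N _ fN] := fg _ (@weakly_compact1 x) e e0.
by exists N => // n Nn; exact: fN.
Qed.

End weak_topologies.

(** Pulling functionals back along [T] gives functionals, which makes [T] continuous for the weak
    topologies. *)
Lemma weakly_compact_image (R : realType) (X Y : completeNormedModType R)
    (T : X -> Y) K :
  (forall g : dual Y, exists f : dual X, f =1 g \o T) ->
  weakly_compact K -> weakly_compact (T @` K).
Proof.
move=> gT Kc; apply: (@continuous_compact (weak X) (weak Y) T) => //.
apply: continuous_subspaceT => x.
have FF := fmap_filter T (@nbhs_filter (weak X) x).
apply/(@weak_cvgP _ _ _ _ FF) => g.
have [f fE] := gT g.
have := @dual_weak_continuous _ X f x.
by have -> : (f : X -> R^o) = g \o T by apply/funext.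
Qed.

(** * Uniform boundedness by a gliding hump in the dual *)

Section gliding_hump.
Context {R : realType} (X : completeNormedModType R).

Definition contraction (f : dual X) := forall x, `|f x| <= `|x|.

(** The bound [b] stands for the norm of [y] in the bidual; keeping it apart from the norm of [y]
    avoids Hahn-Banach and allows a sharper value at the humps. The constant is a geometric tail:
    the powers [4^-n] with [n >= m] add up to [4 / 3 * 4^-m]. *)
Lemma dual_geometric_limit (Psi : nat -> dual X) : Psi 0%N = 0 ->
  (forall n y (b : R), (forall f, contraction f -> `|f y| <= b) ->
     `|Psi n.+1 y - Psi n y| <= 4^-n * b) ->
  exists g : dual X, forall m y (b : R), (forall f, contraction f -> `|f y| <= b) ->
    `|g y - Psi m y| <= 4 / 3 * 4^-m * b.
Proof.
move=> Psi0 PsiS.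
have PsiD m k y (b : R) : (forall f, contraction f -> `|f y| <= b) ->
    `|Psi (m + k)%N y - Psi m y| <= 4 / 3 * 4^-m * b.
  (* The exact partial sum of the geometric series is what the induction on [k] can carry. *)
  move=> yb; suff : `|Psi (m + k)%N y - Psi m y| <= 4 / 3 * (4^-m - 4^-(m + k)) * b.
    move=> /le_trans; apply; rewrite ler_wpM2r//; last rewrite ler_wpM2l//.
      by apply: le_trans (yb 0 _) => // x; rewrite dual0E normr0.
    by rewrite lerBlDr lerDl invr_ge0 exprn_ge0.
  elim: k => [|k IH]; first by rewrite addn0 !subrr normr0 mulr0 mul0r.
  rewrite addnS -(subrKA (Psi (m + k)%N y)) (le_trans (ler_normD _ _))//.
  apply: le_trans (lerD (PsiS _ _ _ yb) IH) _.
  rewrite -mulrDl exprSr invfM; set q := (4 ^+ (m + k))^-1; set r := (4 ^+ m)^-1.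
  by suff -> : q + 4 / 3 * (r - q) = 4 / 3 * (r - q / 4) by []; lra.
have small (b e : R) : 0 <= b -> 0 < e -> exists m, 4 / 3 * 4^-m * b < e.
  move=> b0 e0; pose N := Num.bound (4 / 3 * b / e).
  have : 4 / 3 * b / e < 4 ^+ N.
    apply: lt_trans (archi_boundP _) _; first by rewrite !mulr_ge0// invr_ge0 ltW.
    by rewrite -natrX ltr_nat ltn_expl.
  rewrite ltr_pdivrMr// => be; exists N.
  have -> : 4 / 3 * 4^-N * b = (4 / 3 * b) / 4 ^+ N by rewrite mulrAC.
  by rewrite ltr_pdivrMr ?exprn_gt0// [e * _]mulrC.
have contrE y f : contraction f -> `|f y| <= `|y| by exact.
have cvgPsi y : cvg (Psi n y @[n --> \oo]).
  apply: cauchy_cvg; apply/cauchyP => e e0.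
  have [m mS] := small _ _ (normr_ge0 y) e0.
  exists (Psi m y); exists m => //= n mn; rewrite -ball_normE/= distrC.
  by rewrite -(subnKC mn); apply: le_lt_trans (PsiD _ _ _ _ (contrE y)) mS.
pose g y : R^o := lim (Psi n y @[n --> \oo]).
have gE m y (b : R) : (forall f, contraction f -> `|f y| <= b) ->
    `|g y - Psi m y| <= 4 / 3 * 4^-m * b.
  move=> yb; apply/ler_addgt0Pr => e e0.
  have /cvgrPdist_lt/(_ _ e0) [N _ gN] := cvgPsi y.
  rewrite -(subrKA (Psi (m + N)%N y)) addrC (le_trans (ler_normD _ _))//.
  by rewrite lerD// ?PsiD// ltW//; apply: gN => /=; rewrite leq_addl.
have glin : linear g.
  move=> a y z; rewrite /g; apply: (cvg_lim (@Rhausdorff R)) => //.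
  have -> : (fun n => Psi n (a *: y + z)) = (fun n => a * Psi n y + Psi n z).
    by apply/funext => n; rewrite linearP.
  apply: cvgD; last exact: cvgPsi.
  by apply: cvgMr; exact: cvgPsi.
have gd : g \in is_dual (X := X).
  apply: (@is_dual_bounded _ _ _ (4 / 3)) => // y.
  by have := gE 0%N y _ (contrE y); rewrite Psi0 dual0E subr0 expr0 invr1 mulr1.
by exists (Dual gd).
Qed.

(** Otherwise there are points x_n of [K] and contractions f_n with |f_n x_n| > 3 n 4^n; a signed
    series of the functionals 4^-n f_n is then a continuous functional larger than n at x_n, against
    its boundedness on [K]. *)
Lemma weakly_bounded_uniform (K : set X) :
  (forall f : dual X, exists M : R, forall x, K x -> `|f x| <= M) ->
  exists2 M : R, 0 < M & forall (f : dual X) (c : R), 0 < c ->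
    (forall x, `|f x| <= c * `|x|) -> forall x, K x -> `|f x| <= M * c.
Proof.
move=> Kb.
suff [M KM] : exists M : R, forall f x, contraction f -> K x -> `|f x| <= M.
  exists (`|M| + 1) => [|f c c0 fc x Kx]; first by rewrite ltr_wpDl.
  have := KM (c^-1 *: f) x _ Kx; rewrite dualZE normrM gtr0_norm ?invr_gt0//.
  rewrite ler_pdivrMl// mulrC => /(_ _)/le_trans; apply; last first.
    by rewrite ler_wpM2r ?(ltW c0)// (le_trans (ler_norm _))// lerDl.
  by move=> y; rewrite dualZE normrM gtr0_norm ?invr_gt0// ler_pdivrMl.
apply: contrapT => /forallNP unb.
have /choice[F FP] n : exists xf : X * dual X, [/\ K xf.1, contraction xf.2,
    3 * n%:R * 4 ^+ n < `|xf.2 xf.1| &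
    forall f, contraction f -> `|f xf.1| <= 2 * `|xf.2 xf.1|].
  (* The target is doubled because [h] below reaches only half of the supremum over all
     contractions; in return no contraction exceeds twice the value of [h] at [x]. *)
  have /existsNP[f /existsNP[x]] := unb (2 * (3 * n%:R * 4 ^+ n)).
  move=> /not_implyP[fc] /not_implyP[Kx /negP]; rewrite -ltNge => fx.
  pose A := [set `|h x| | h in contraction].
  have As : has_sup A.
    split; first by exists `|f x|, f.
    by exists `|x| => _ [h hc <-]; exact: hc.
  have fs : `|f x| <= sup A by apply: sup_upper_bound => //; exists f.
  have n0 : 0 <= 2 * (3 * n%:R * 4 ^+ n) :> R by rewrite !mulr_ge0 ?exprn_ge0.
  have s0 : 0 < sup A by apply: lt_le_trans fs; exact: le_lt_trans fx.
  have s20 : 0 < sup A / 2 by rewrite divr_gt0.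
  have [_ [h hc <-] hx] := sup_adherent s20 As.
  exists (x, h); split => //=; first by lra.
  move=> k kc; have : `|k x| <= sup A by apply: sup_upper_bound => //; exists k.
  by move=> ?; lra.
(* The sign makes the new value at the [n]-th point at least as large as the
   increment there; later increments are too small to cancel it. *)
pose step n (P : dual X) : dual X :=
  let h := 4^-n *: (F n).2 in
  if `|h (F n).1| <= `|P (F n).1 + h (F n).1| then P + h else P - h.
have reflect_le (p h : R) : `|p + h| < `|h| -> `|h| <= `|p - h|.
  move=> lt; have := ler_normB (p + h) (p - h).
  have -> : p + h - (p - h) = 2 * h by ring.
  by rewrite normrM ger0_norm//; lra.
have stepE n P : `|4^-n * (F n).2 (F n).1| <= `|step n P (F n).1|.
  rewrite /step -dualZE; case: ifPn; rewrite ?dualDE ?dualNE// -ltNge => lt.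
  exact: reflect_le.
pose Psi := fix Psi n := if n is m.+1 then step m (Psi m) else 0.
have [|n y b yb|g gP] := @dual_geometric_limit Psi; first by [].
  have -> : `|Psi n.+1 y - Psi n y| = 4^-n * `|(F n).2 y|.
    rewrite /= /step; case: ifPn => _; rewrite !dualDE ?dualNE dualZE.
      by rewrite addrC addKr normrM gtr0_norm.
    by rewrite addrC addKr normrN normrM gtr0_norm.
  by rewrite ler_wpM2l//; apply: yb; have [] := FP n.
have [M gM] := Kb g.
pose n := Num.bound `|M|.
have [KF _ Fn Fb] := FP n.
have Mn : M < n%:R.
  exact: le_lt_trans (ler_norm M) (archi_boundP (normr_ge0 M)).
set x := (F n).1 in KF Fn Fb *; set a : R := `|(F n).2 x| in Fn Fb *.
(* Increments after stage [n] change the value at [x] by at most [4 / 3 * 4^-(n.+1) * (2 * a)], two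
   thirds of [4^-n * a]. At least a third is left, and it exceeds [n], hence [M]. *)
have := gP n.+1 _ _ Fb; have := stepE n (Psi n); rewrite -/(Psi n.+1) -/x.
rewrite normrM gtr0_norm ?invr_gt0 ?exprn_gt0// -/a exprSr invfM.
have := gM _ KF; have := ler_normB (g x) (g x - Psi n.+1 x); rewrite subKr.
have : 3 * n%:R < 4^-n * a by rewrite [4^-n * a]mulrC ltr_pdivlMr ?exprn_gt0.
set q := (4 ^+ n)^-1.
have -> : 4 / 3 * (q / 4) * (2 * a) = 2 / 3 * (q * a) by field.
by set t := q * a; lra.
Qed.

End gliding_hump.

(** * Restrictions and single coordinates in the l^p-sum *)

Section lp_tools.
Context {R : realType} {I : Type} (X : I -> completeNormedModType R) (p : R).
Hypothesis p1 : 1 <= p.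

Local Notation E := (lp_sum X p1).
Local Notation J := {classic I}.
Implicit Types (A B : set J) (F G : {fset J}) (x y : E).

Let p0 : 0 < p. Proof. exact: lt_le_trans p1. Qed.

Lemma lp_sumDE x y i : (x + y) i = x i + y i. Proof. by []. Qed.
Lemma lp_sumNE x i : (- x) i = - x i. Proof. by []. Qed.
Lemma lp_sumZE (a : R) x i : (a *: x) i = a *: x i. Proof. by []. Qed.

Lemma lp_mass_norm x : lp_mass p x = (`|x| `^ p)%:E.
Proof. exact: lp_massE. Qed.

Lemma le_lp_mass (u v : forall i, X i) :
  (forall i, `|u i| <= `|v i|) -> (lp_mass p u <= lp_mass p v)%E.
Proof.
move=> uv; apply: le_esum => i _; rewrite lee_fin.
by apply: ge0_ler_powR; rewrite ?nnegrE ?(ltW p0).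
Qed.

Lemma le_lp_norm x y : (forall i, `|x i| <= `|y i|) -> `|x| <= `|y|.
Proof.
move=> xy; apply/(lp_norm_leP _ (normr_ge0 y)).
by rewrite -lp_mass_norm; exact: le_lp_mass.
Qed.

Lemma lp_sum_le F x : \sum_(i <- F) `|x i| `^ p <= `|x| `^ p.
Proof.
have /lp_mass_leP : (lp_mass p x <= (`|x| `^ p)%:E)%E by rewrite lp_mass_norm lexx.
exact.
Qed.

Definition supported A x := forall i, ~ A i -> x i = 0.

(** At each coordinate one of the two terms is zero, so the masses add up termwise. *)
Lemma lp_normD_disjoint A x y : supported A x -> supported (~` A) y ->
  `|x + y| `^ p = `|x| `^ p + `|y| `^ p.
Proof.
move=> xA yA.
suff : (lp_mass p (x + y)%R = lp_mass p x + lp_mass p y)%E.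
  by rewrite !lp_mass_norm; case.
rewrite /lp_mass -esumD; try by move=> i _; rewrite lee_fin powR_ge0.
apply: eq_esum => i _; rewrite -EFinD lp_sumDE; congr (_%:E).
have [Ai|nAi] := pselect (A i).
  by rewrite yA; [rewrite addr0 normr0 powR0 ?gt_eqF// addr0|exact].
by rewrite xA// add0r normr0 powR0 ?gt_eqF// add0r.
Qed.

Lemma lp_restrict_finite A x :
  (lp_mass p (fun i => if `[< A i >] then x i else 0%R) < +oo)%E.
Proof.
apply: le_lt_trans (lp_finite x); apply: le_lp_mass => i.
by case: ifP => // _; rewrite normr0.
Qed.

Definition lp_restrict A x : E := LpSum p1 (lp_restrict_finite A x).

Lemma lp_restrictE A x i : A i -> lp_restrict A x i = x i.
Proof. by move=> Ai; rewrite /= asboolT. Qed.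

Lemma lp_restrict_out A x i : ~ A i -> lp_restrict A x i = 0.
Proof. by move=> Ai; rewrite /= asboolF. Qed.

Lemma supported_restrict A x : supported A (lp_restrict A x).
Proof. by move=> i; exact: lp_restrict_out. Qed.

Lemma supportedS A B x : A `<=` B -> supported A x -> supported B x.
Proof. by move=> AB xA i nB; apply: xA => /AB. Qed.

Lemma lp_restrict_norm A x : `|lp_restrict A x| <= `|x|.
Proof. by apply: le_lp_norm => i /=; case: ifP => // _; rewrite normr0. Qed.

Lemma lp_restrictC A x : x = lp_restrict A x + lp_restrict (~` A) x.
Proof.
apply: lp_sumP => i; rewrite lp_sumDE.
have [Ai|nAi] := pselect (A i).
  by rewrite lp_restrictE// lp_restrict_out ?addr0// => /(_ Ai).
by rewrite lp_restrict_out// (@lp_restrictE (~` A))// add0r.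
Qed.

Lemma lp_norm_split A x :
  `|x| `^ p = `|lp_restrict A x| `^ p + `|lp_restrict (~` A) x| `^ p.
Proof.
rewrite -(lp_normD_disjoint (@supported_restrict A x) (@supported_restrict _ x)).
by rewrite -lp_restrictC.
Qed.

Lemma lp_restrict_linear A : linear (lp_restrict A).
Proof.
move=> a x y; apply: lp_sumP => i; rewrite lp_sumDE lp_sumZE.
have [Ai|nAi] := pselect (A i).
  by rewrite !lp_restrictE// lp_sumDE lp_sumZE.
by rewrite !lp_restrict_out// scaler0 addr0.
Qed.

(** Some finite set carries all of the mass up to e^p, and the p-th powers of the norms on this set
    and on its complement add up to that of [x]. *)
Lemma lp_restrict_tail x (e : R) : 0 < e ->
  exists F, `|lp_restrict (~` [set` F]) x| <= e.
Proof.
have key (n a b e' s : R) : n = a + b -> n - e' < s -> s <= a -> e' < b -> False.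
  by lra.
move=> e0; have ep0 : 0 < e `^ p by rewrite powR_gt0.
have : ((`|x| `^ p - e `^ p)%:E < lp_mass p x)%E.
  by rewrite lp_mass_norm lte_fin gtrDl oppr_lt0.
move=> /ereal_sup_gt[_ [A [Af _] <-]]; rewrite fsbig_finite//= sumEFin lte_fin => xF.
exists (fset_set A); set F := fset_set A in xF *.
rewrite leNgt; apply/negP => eF.
have eF' : e `^ p < `|lp_restrict (~` [set` F]) x| `^ p.
  by apply: gt0_ltr_powR; rewrite ?nnegrE// ltW.
have SF : \sum_(i <- F) `|x i| `^ p <= `|lp_restrict [set` F] x| `^ p.
  apply: le_trans (lp_sum_le F (lp_restrict [set` F] x)).
  by rewrite big_seq [leRHS]big_seq; apply: ler_sum => i iF; rewrite lp_restrictE.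
exact: key (lp_norm_split _ x) xF SF eF'.
Qed.

Lemma lp_mass_single (i : J) (v : X i) :
  (lp_mass p (dfwith (fun j : J => 0%R : X j) i v) <= (`|v| `^ p)%:E)%E.
Proof.
apply/lp_mass_leP => F; have [iF|iF] := boolP (i \in F).
  rewrite (big_fsetD1 i)//= dfwithin big_seq big1 ?addr0// => j.
  by rewrite !inE => /andP[ji _]; rewrite dfwithout ?normr0 ?powR0 ?gt_eqF// eq_sym.
rewrite big_seq big1 ?powR_ge0// => j jF.
rewrite dfwithout ?normr0 ?powR0 ?gt_eqF//.
by apply: contraNneq iF => ->.
Qed.

Lemma lp_single_finite (i : J) (v : X i) :
  (lp_mass p (dfwith (fun j : J => 0%R : X j) i v) < +oo)%E.
Proof. by apply: le_lt_trans (lp_mass_single v) _; exact: ltry. Qed.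

Definition lp_single (i : J) (v : X i) : E := LpSum p1 (lp_single_finite v).

Lemma lp_singleE (i : J) (v : X i) : lp_single v i = v.
Proof. exact: dfwithin. Qed.

Lemma lp_single_out (i j : J) (v : X i) : i != j -> lp_single v j = 0.
Proof. exact: dfwithout. Qed.

Lemma lp_single_linear (i : J) : linear (@lp_single i).
Proof.
move=> a v w; apply: lp_sumP => j; rewrite lp_sumDE lp_sumZE.
have [<-|ij] := eqVneq i j; first by rewrite !lp_singleE.
by rewrite !lp_single_out// scaler0 addr0.
Qed.

Lemma lp_single_norm (i : J) (v : X i) : `|lp_single v| <= `|v|.
Proof.
apply/(lp_norm_leP _ (normr_ge0 v)); exact: lp_mass_single.
Qed.

Lemma lp_restrict_fset F x :
  lp_restrict [set` F] x = \sum_(i <- F) lp_single (x i).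
Proof.
(* The index is retyped as an element of [{classic I}], where equality and membership in [F] are
   decidable. *)
apply: lp_sumP => j; rewrite -[j]/(j : J); move: (j : J) => {}j.
have -> : (\sum_(i <- F) lp_single (x i)) j = \sum_(i <- F) lp_single (x i) j.
  by elim/big_rec2: _ => // i y z _ <-.
have [jF|jF] := boolP (j \in F).
  rewrite lp_restrictE// (big_fsetD1 j jF) lp_singleE big_seq big1 => [|i].
    by rewrite /= addr0.
  by rewrite !inE => /andP[ij _]; rewrite lp_single_out.
rewrite lp_restrict_out ?big_seq ?big1// => [i iF|]; last exact/negP.
by rewrite lp_single_out//; apply: contraNneq jF => <-.
Qed.

End lp_tools.

(** * A Young-type inequality for powers *)

Section young.
Context {R : realType} (p : R).

(** Either [t <= d], or [t / d] is at least 1 and is dominated by its p-th power. *)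
Lemma le_powR_young (d t : R) : 1 <= p -> 0 < d -> 0 <= t ->
  t <= d + d / d `^ p * t `^ p.
Proof.
move=> p1 d0 t0.
have s0 : 0 <= t / d by rewrite divr_ge0// ltW.
have st : t / d <= 1 + (t / d) `^ p.
  have [s1|/ltW s1] := leP (t / d) 1; first by rewrite (le_trans s1)// lerDl powR_ge0.
  by rewrite (le_trans (le1r_powR s1 p1))// lerDr.
move: st; rewrite ler_pdivrMr// => /le_trans; apply.
rewrite mulrDl mul1r lerD2l powRM ?invr_ge0 ?(ltW d0)//.
rewrite -powR_inv1 ?(ltW d0)// powRAC powR_inv1 ?powR_ge0//.
by set a := t `^ p; set b := (d `^ p)^-1; suff -> : a * b * d = d * b * a by []; ring.
Qed.

(** As p > 1, the equation d^(1-p) = k is solved by d = k^(-1/(p-1)). A norm can thus be charged to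
    its p-th power at an arbitrarily small rate. *)
Lemma le_powR_young_small (k : R) : 1 < p -> 0 < k ->
  exists2 d : R, 0 < d & forall t, 0 <= t -> t <= d + k * t `^ p.
Proof.
move=> p1 k0; have q0 : p - 1 != 0 by rewrite subr_eq0 gt_eqF.
pose d := k^-1 `^ (p - 1)^-1.
have d0 : 0 < d by rewrite powR_gt0 ?invr_gt0.
exists d => // t t0; have := le_powR_young (ltW p1) d0 t0.
suff -> : d / d `^ p = k by [].
have -> : d `^ p = d * k^-1; last by rewrite invfM mulrA divff ?gt_eqF// mul1r invrK.
rewrite -[p in LHS](subrKC 1) powRD; last by rewrite (gt_eqF d0) implybT.
by rewrite powRr1 ?(ltW d0)// /d -powRrM mulVf// powRr1// invr_ge0 ltW.
Qed.

End young.

(** * Smallness of functionals outside finite sets of coordinates *)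

Section tails.
Context {R : realType} {I : Type} (X : I -> completeNormedModType R) (p : R).
Hypothesis p1 : 1 <= p.

Local Notation E := (lp_sum X p1).
Local Notation J := {classic I}.
Implicit Types (A B : set J) (F G : {fset J}) (x y : E) (h : dual E).

Definition supp_le A h (c : R) := forall x, supported A x -> `|h x| <= c * `|x|.

Lemma supp_leS A B h (c : R) : A `<=` B -> supp_le B h c -> supp_le A h c.
Proof. by move=> AB hB x xA; apply: hB; exact: supportedS xA. Qed.

Lemma is_convex_supp_le A (c : R) : is_convex [set h | supp_le A h c].
Proof.
move=> t f g /andP[t0 t1] fA gA x xA; rewrite dualDE !dualZE.
have s0 : 0 <= 1 - t by rewrite subr_ge0.
rewrite (le_trans (ler_normD _ _))// !normrM (ger0_norm t0) (ger0_norm s0).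
have -> : c * `|x| = t * (c * `|x|) + (1 - t) * (c * `|x|) by ring.
by rewrite lerD// ler_wpM2l//; [exact: fA|exact: gA].
Qed.

Lemma supp_le_unit A h (c : R) :
  (forall x, supported A x -> `|x| = 1 -> `|h x| <= c) -> supp_le A h c.
Proof.
move=> hA x xA; have [->|x0] := eqVneq x 0; first by rewrite linear0 !normr0 mulr0.
have xn : 0 < `|x| by rewrite normr_gt0.
rewrite -ler_pdivrMr// mulrC.
have -> : `|x|^-1 * `|h x| = `|h (`|x|^-1 *: x)|.
  by rewrite linearZ normrM gtr0_norm ?invr_gt0.
apply: hA; last by rewrite normrZ gtr0_norm ?invr_gt0// mulVf ?gt_eqF.
by move=> i nAi; rewrite lp_sumZE xA// scaler0.
Qed.

Lemma supportedD A x y : supported A x -> supported A y -> supported A (x + y).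
Proof. by move=> xA yA i nA; rewrite lp_sumDE xA// yA// addr0. Qed.

Lemma lp_restrictU A B x :
  lp_restrict (A `|` B) x = lp_restrict A x + lp_restrict (B `\` A) x.
Proof.
apply: lp_sumP => i; rewrite lp_sumDE.
have [Ai|nA] := pselect (A i).
  rewrite lp_restrictE; last by left.
  by rewrite lp_restrictE// lp_restrict_out ?addr0// => -[].
rewrite (lp_restrict_out _ nA) add0r.
have [Bi|nB] := pselect (B i); first by rewrite !lp_restrictE//; right.
by rewrite !lp_restrict_out// => -[].
Qed.

Lemma lp_norm_restrictU A B x : `|lp_restrict (A `|` B) x| `^ p =
  `|lp_restrict A x| `^ p + `|lp_restrict (B `\` A) x| `^ p.
Proof.
rewrite lp_restrictU; apply: (@lp_normD_disjoint _ _ _ _ _ A).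
  exact: supported_restrict.
by apply: (@supportedS _ _ _ _ _ (B `\` A)) => [i []//|]; exact: supported_restrict.
Qed.

Lemma lp_restrict_powR A x : `|lp_restrict A x| `^ p <= `|x| `^ p.
Proof. by rewrite [leRHS](lp_norm_split A) lerDl powR_ge0. Qed.

Lemma supported_restrictI A B x :
  supported A x -> supported (A `&` B) (lp_restrict B x).
Proof.
move=> xA i nAB; have [Bi|nB] := pselect (B i); last exact: lp_restrict_out.
by rewrite lp_restrictE// xA// => Ai; apply: nAB.
Qed.

(** Finite truncations approximate [x] in norm and [h] is bounded by [C]; an error [e / C] in norm
    costs at most [e] in value. *)
Lemma supp_le_fin A h (c : R) : 0 <= c -> (forall F, supp_le (A `&` [set` F]) h c) ->
  supp_le A h c.
Proof.
move=> c0 hA; apply: supp_le_unit => x xA x1; apply/ler_addgt0Pr => e e0.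
have [C C0 hC] := dual_bounded h.
have [F xF] := lp_restrict_tail x (divr_gt0 e0 C0).
rewrite {1}(lp_restrictC [set` F] x) linearD (le_trans (ler_normD _ _))//.
apply: lerD; last first.
  by rewrite (le_trans (hC _))// mulrC -ler_pdivlMr.
apply: le_trans (hA F _ (supported_restrictI xA)) _.
by rewrite ler_piMr// -x1; exact: lp_restrict_norm.
Qed.

Lemma not_supp_le A h (c : R) : ~ supp_le A h c ->
  exists x, [/\ supported A x, `|x| = 1 & c < h x].
Proof.
move=> hA; apply: contrapT => nx; apply: hA; apply: supp_le_unit => x xA x1.
rewrite leNgt; apply/negP => cx; apply: nx.
have [hx|hx] := leP 0 (h x).
  by exists x; split => //; rewrite -(ger0_norm hx).
exists (- x); split; [|by rewrite normrN|by rewrite linearN -(ltr0_norm hx)].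
by move=> i nA; rewrite lp_sumNE xA// oppr0.
Qed.

Hypothesis hp : 1 < p.

(** Otherwise every finite set leaves room for a further one carrying unit vectors on which [u n]
    exceeds [e]. Along an ultrafilter this failure holds for almost all [n], so [m] stages can be
    intersected and one [n] sees [m] disjoint unit vectors. Their sum has norm at most m^(1/p) and
    value at least [m * e], too large against [C] as p > 1. *)
Lemma ultra_tails (U : set_system nat) (u : nat -> dual E) (C e : R) :
  UltraFilter U -> (forall n x, `|u n x| <= C * `|x|) -> 0 < e ->
  exists F0, forall F, \forall n \near U, supp_le ([set` F] `\` [set` F0]) (u n) e.
Proof.
move=> UU uC e0.
have key2 (D d M v t s : R) : 0 < D -> 2 * D * d < M * e -> M * e <= v ->
    v <= D * t -> t <= d + e / 2 / D * s -> s <= M -> False.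
  move=> D0 h1 h2 h3 h4 h5.
  have h6 : D * t <= D * d + e / 2 * s.
    have -> : e / 2 * s = D * (e / 2 / D * s) by field; rewrite gt_eqF.
    by rewrite -mulrDr ler_wpM2l// ltW.
  have : e / 2 * s <= e / 2 * M by rewrite ler_wpM2l// divr_ge0// ltW.
  by lra.
apply: contrapT => /forallNP H.
have {}H F0 : exists F, \forall n \near U, exists x,
    [/\ supported ([set` F] `\` [set` F0]) x, `|x| = 1 & e < u n x].
  have /existsNP[F HF] := H F0; exists F.
  have [//|] := in_ultra_setVsetC [set n | supp_le ([set` F] `\` [set` F0]) (u n) e] UU.
  by apply: filterS => n /not_supp_le.
have grow m : exists G, \forall n \near U, exists x,
    [/\ supported [set` G] x, `|x| `^ p <= m%:R & m%:R * e <= u n x].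
  elim: m => [|m [G HG]].
    exists fset0; apply: filterE => n; exists 0; split => //.
      by rewrite normr0 powR0// gt_eqF// (lt_trans _ hp).
    by rewrite mul0r linear0.
  have [F HF] := H G; exists (F `|` G)%fset.
  apply: filterS2 HG HF => n [x [xG xm ux]] [y [yF y1 uy]]; exists (y + x); split.
  - by apply: supportedD; [apply: supportedS yF => i [iF _]|apply: supportedS xG => i iG];
      rewrite /= inE; apply/orP; [left|right].
  - rewrite addrC (lp_normD_disjoint xG); last by apply: supportedS yF => i [].
    by rewrite y1 powR1 -natr1 lerD2r.
  - by rewrite linearD -natr1 mulrDl mul1r addrC; apply: lerD => //; exact: ltW.
have C1 : 0 < `|C| + 1 by rewrite ltr_wpDl.
(* Put D = |C| + 1. At the rate [e / 2 / D], D times a norm whose p-th power is at most m is at most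
   D d + m e / 2, which is below m e once 2 D d < m e. *)
have [d d0 dP] := le_powR_young_small hp (divr_gt0 (divr_gt0 e0 (ltr0n R 2)) C1).
pose m := Num.bound (2 * (`|C| + 1) * d / e).
have me : 2 * (`|C| + 1) * d < m%:R * e.
  rewrite -ltr_pdivrMr//; apply: archi_boundP.
  by rewrite divr_ge0 ?mulr_ge0// ltW.
have [G /filter_ex[n [x [_ xm ux]]]] := grow m.
have uCx : u n x <= (`|C| + 1) * `|x|.
  rewrite (le_trans (ler_norm _))// (le_trans (uC n x))// ler_wpM2r//.
  by rewrite (le_trans (ler_norm C))// lerDl.
exact: (key2 _ _ _ _ _ _ C1) me ux uCx (dP _ (normr_ge0 x)) xm.
Qed.

(** This is [ultra_tails] for a constant sequence: a statement free of [n] that holds along the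
    ultrafilter simply holds, and [supp_le_fin] removes the finite outer set. *)
Lemma dual_tail h (e : R) : 0 < e -> exists F, supp_le (~` [set` F]) h e.
Proof.
move=> e0; have [C C0 hC] := dual_bounded h.
have [U [UU _]] := @ultraFilterLemma nat \oo _.
have [F0 HF0] := @ultra_tails U (fun=> h) C e UU (fun=> hC) e0.
exists F0; apply: supp_le_fin => [|F]; first exact: ltW.
have /filter_ex[_] := HF0 F.
by apply: supp_leS => i [nF0 Fi].
Qed.

(* Beyond [F0] the functionals are almost disjointly supported along a
   subsequence, and the average of [m] disjoint pieces has norm [O(m^(1/p-1))]. *)
Lemma hull_small_tails (u : nat -> dual E) (C e : R) :
  0 < C -> (forall n x, `|u n x| <= C * `|x|) -> 0 < e ->
  exists F0, forall r, exists v, hull (tail u r) v /\ supp_le (~` [set` F0]) v e.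
Proof.
have key (d e' k t a b c : R) : 0 < C -> C * d <= e' -> t <= d + k * b -> a <= e' ->
    c <= e' -> a + (C * t + c) <= 3 * e' + C * k * b.
  move=> C0 Cd td ae ce.
  have h : C * t <= C * d + C * k * b by rewrite -mulrA -mulrDr ler_wpM2l// ltW.
  by lra.
have key2 (m w v e' c a b : R) : w <= m * (3 * e') + c * a -> v <= 3 * e' + c * b ->
    w + v <= (m + 1) * (3 * e') + c * (a + b).
  by lra.
have key3 (m : nat) : 1 - m%:R / m.+1%:R = m.+1%:R^-1 :> R.
  by rewrite -natr1; field; rewrite natr1 pnatr_eq0.
move=> C0 uC e0.
(* Each functional spends three quarters: on old coordinates, on the constant in Young's inequality,
   and on far coordinates. The last quarter absorbs [C * k] divided by [m] after averaging. *)
pose e' := e / 4; have e'0 : 0 < e' by rewrite divr_gt0.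
have [U [UU U_oo]] := @ultraFilterLemma nat \oo _.
have [F0 HF0] := ultra_tails UU uC e'0.
exists F0 => r.
pose d := e' / C; have d0 : 0 < d by rewrite divr_gt0.
have Cd : C * d <= e' by rewrite mulrC divfK// gt_eqF.
pose k := d / d `^ p.
have k0 : 0 <= k by rewrite divr_ge0 ?powR_ge0// ltW.
have Ck0 : 0 <= C * k by rewrite mulr_ge0// ltW.
(* Here [v] is a sum of [m] terms of [u], and [G] holds the coordinates used so far. The second
   error term stays below [C * k] for all [m], since p-th powers of norms on disjoint pieces add up
   to at most 1. At [m = 0] there is no average, hence the separate clause. *)
have sum m : exists v G, [/\ (0 < m)%N -> hull (tail u r) (m%:R^-1 *: v),
    m = 0%N -> v = 0 & forall x, supported (~` [set` F0]) x -> `|x| <= 1 ->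
    `|v x| <= m%:R * (3 * e') + C * k * `|lp_restrict [set` G] x| `^ p].
  elim: m => [|m [v [G [vh v0 vG]]]].
    exists 0, fset0; split => // x _ _.
    by rewrite dual0E normr0 mul0r add0r mulr_ge0// powR_ge0.
  have rU : U [set n | (r <= n)%N] by apply: U_oo; exact: nbhs_infty_ge.
  have [n [/= rn unG]] := filter_ex (filterI rU (HF0 G)).
  have [F unF] := dual_tail (u n) e'0.
  exists (v + u n), (G `|` F)%fset; split=> [_|//|x xF0 x1].
    have un : hull (tail u r) (u n) by apply: sub_hull; exists n.
    have [m0|m0] := posnP m; first by rewrite m0 v0// invr1 scale1r add0r.
    have := is_convex_hull (t := m%:R / m.+1%:R) _ (vh m0) un.
    rewrite scalerA mulrAC divff ?mul1r ?pnatr_eq0 -?lt0n//.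
    rewrite key3 -scalerDr; apply.
    by rewrite divr_ge0//= ler_pdivrMr// mul1r ler_nat.
  pose D := [set` F] `\` [set` G].
  have GD : D `<=` ~` [set` G] by move=> i [].
  have xG : lp_restrict [set` (G `|` F)%fset] x =
      lp_restrict [set` G] x + lp_restrict D x.
    by rewrite set_fsetU lp_restrictU.
  (* Three pieces: on old coordinates [u n] is small by choice of [n], beyond [F] by choice of [F];
     only the new coordinates [D] need Young's inequality. *)
  have xE : x = lp_restrict [set` G] x +
      (lp_restrict D x + lp_restrict (~` [set` (G `|` F)%fset]) x).
    by rewrite addrA -xG -lp_restrictC.
  have xS : `|lp_restrict [set` (G `|` F)%fset] x| `^ p =
      `|lp_restrict [set` G] x| `^ p + `|lp_restrict D x| `^ p.
    by rewrite set_fsetU; exact: lp_norm_restrictU.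
  have le1 A : `|lp_restrict A x| <= 1 by rewrite (le_trans (lp_restrict_norm _ _)).
  have unx : `|u n x| <= 3 * e' + C * k * `|lp_restrict D x| `^ p.
    rewrite {1}xE !linearD.
    apply: le_trans (ler_normD _ _) _; apply: le_trans (lerD (lexx _) (ler_normD _ _)) _.
    apply: le_trans (lerD (lexx _) (lerD (uC n _) (lexx _))) _.
    apply: key C0 Cd (le_powR_young p1 d0 (normr_ge0 _)) _ _.
      apply: le_trans (unG _ _) _; last exact: ler_piMr (ltW e'0) (le1 _).
      by apply: supportedS (supported_restrictI xF0) => i [].
    apply: le_trans (unF _ _) _; last exact: ler_piMr (ltW e'0) (le1 _).
    apply: supportedS (@supported_restrict _ _ _ _ _ _ _) => i /= nFG iF.
    by apply: nFG; rewrite inE; apply/orP; right.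
  rewrite dualDE xS -natr1; apply: le_trans (ler_normD _ _) _.
  exact: key2 (vG _ xF0 x1) unx.
pose m := (Num.bound (C * k / e')).+1.
have [v [G [vh _ vG]]] := sum m.
exists (m%:R^-1 *: v); split; first exact: vh.
apply: supp_le_unit => x xF0 x1.
have m0 : 0 < m%:R :> R by rewrite ltr0n.
rewrite dualZE normrM gtr0_norm ?invr_gt0// mulrC ler_pdivrMr//.
have x1' : `|x| <= 1 by rewrite x1.
apply: le_trans (vG x xF0 x1') _.
have Ckm : C * k <= m%:R * e'.
  rewrite -ler_pdivrMr// (le_trans (ltW (archi_boundP _)))//.
    by rewrite divr_ge0// ltW.
  by rewrite ler_nat.
have xp : `|lp_restrict [set` G] x| `^ p <= 1.
  by apply: le_trans (lp_restrict_powR _ _) _; rewrite x1 powR1.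
apply: (@le_trans _ _ (m%:R * (3 * e') + m%:R * e')).
  by rewrite lerD2l; apply: le_trans Ckm; exact: ler_piMr.
rewrite -mulrDr mulrC ler_wpM2r ?(ltW m0)// /e'.
by suff -> : 3 * (e / 4) + e / 4 = e by []; field.
Qed.

End tails.

(** * Bounds and pointwise convergence under passage to blocks *)

Section dual_convex.
Context {R : realType} (X : completeNormedModType R).

(** The bound may depend on the point, so norm bounds and uniform bounds on [K] both pass to blocks
    by [block_of_near]. *)
Lemma is_convex_dual_le (K : set X) (c : X -> R) :
  is_convex [set h : dual X | forall x, K x -> `|h x| <= c x].
Proof.
move=> t f g /andP[t0 t1] fc gc x Kx; rewrite dualDE !dualZE.
have s0 : 0 <= 1 - t by rewrite subr_ge0.
rewrite (le_trans (ler_normD _ _))// !normrM (ger0_norm t0) (ger0_norm s0).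
have -> : c x = t * c x + (1 - t) * c x by ring.
by rewrite lerD// ler_wpM2l//; [exact: fc|exact: gc].
Qed.

Lemma weak_star_bounded (u : nat -> dual X) :
  (forall x, cvg (u n x @[n --> \oo])) ->
  exists2 C : R, 0 < C & forall n x, `|u n x| <= C * `|x|.
Proof.
move=> ux; have : uniform_bounded (range (fun n => u n : X -> R^o)).
  apply: Banach_Steinhauss => [_ [n _ <-]|x].
    split; last exact: dual_linear.
    move=> r; have [C C0 uC] := dual_bounded (u n).
    by exists (C * r) => x xr; rewrite (le_trans (uC x))// ler_wpM2l// ltW.
  have [M [_ uM]] := cvg_seq_bounded (ux x).
  by exists (M + 1) => _ [n _ <-]; apply: uM => //; rewrite ltrDl.
move=> /(_ 1)[M uM]; exists (`|M| + 1) => [|n x]; first by rewrite ltr_wpDl.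
have [->|x0] := eqVneq x 0; first by rewrite linear0 !normr0 mulr0.
have xn : 0 < `|x| by rewrite normr_gt0.
have : `|u n (`|x|^-1 *: x)| <= M.
  apply: (uM (u n : X -> R^o)); first by exists n.
  by rewrite normrZ gtr0_norm ?invr_gt0// mulVf ?gt_eqF.
rewrite linearZ normrM gtr0_norm ?invr_gt0// ler_pdivrMl// => /le_trans; apply.
by rewrite mulrC ler_wpM2r// (le_trans (ler_norm M))// lerDl.
Qed.

(** Weak* convergence to zero, with the non-strict inequality that [is_convex_dual_le] handles. *)
Definition pointwise_null (h : nat -> dual X) := forall x (e : R), 0 < e ->
  \forall n \near \oo, `|h n x| <= e.

Lemma pointwise_nullP (h : nat -> dual X) :
  pointwise_null h <-> forall x, h n x @[n --> \oo] --> (0 : R^o).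
Proof.
split=> [h0 x|h0 x e e0].
  apply/cvgrPdist_le => e e0; apply: filterS (h0 x e e0) => n.
  by rewrite sub0r normrN.
have /cvgrPdist_le/(_ e e0) := h0 x.
by apply: filterS => n; rewrite sub0r normrN.
Qed.

Lemma pointwise_null_block (h d : nat -> dual X) :
  block_of d h -> pointwise_null h -> pointwise_null d.
Proof.
move=> dh h0 x e e0.
have := block_of_near (@is_convex_dual_le [set x] (fun=> e)) dh.
have H : \forall n \near \oo, forall y, [set x] y -> `|h n y| <= e.
  by apply: filterS (h0 x e e0) => n hx y ->.
by move=> /(_ H); apply: filterS => n; exact.
Qed.

End dual_convex.

(** * Property (K) on finitely many coordinates *)

Section coordinates.
Context {R : realType} {I : Type} (X : I -> completeNormedModType R) (p : R).
Hypothesis p1 : 1 <= p.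

Local Notation E := (lp_sum X p1).
Local Notation J := {classic I}.

Lemma is_dual_single (i : J) (h : dual E) :
  (h \o @lp_single _ _ X p p1 i : X i -> R^o) \in is_dual (X := X i).
Proof.
have [C C0 hC] := dual_bounded h.
apply: (@is_dual_bounded _ _ _ C) => [a v w|v] /=.
  by rewrite lp_single_linear linearP.
by apply: le_trans (hC _) _; rewrite ler_wpM2l ?(ltW C0)//; exact: lp_single_norm.
Qed.

Definition dual_single (i : J) (h : dual E) : dual (X i) := Dual (is_dual_single i h).

Lemma weakly_compact_coord (i : J) (K : set E) :
  weakly_compact K -> weakly_compact ((fun x : E => x i) @` K).
Proof.
apply: weakly_compact_image => g.
have [C C0 gC] := dual_bounded g.
have gd : ((fun x : E => g (x i)) : E -> R^o) \in is_dual (X := E).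
  apply: (@is_dual_bounded _ _ _ C) => [a x y|x]; first by rewrite -linearP.
  apply: le_trans (gC _) _; rewrite ler_wpM2l ?(ltW C0)//; exact: lp_coord_le.
by exists (Dual gd).
Qed.

(** This is Mackey convergence to zero of [dual_single i (h n)], phrased through [h] itself so that
    [block_of_near] applies. *)
Definition mackey_null (i : J) (h : nat -> dual E) := forall K : set (X i),
  weakly_compact K -> forall e : R, 0 < e ->
  \forall n \near \oo, forall v, K v -> `|h n (lp_single p1 v)| <= e.

Lemma mackey_null_block (i : J) (h d : nat -> dual E) :
  block_of d h -> mackey_null i h -> mackey_null i d.
Proof.
move=> dh h0 K Kc e e0.
have := block_of_near (@is_convex_dual_le _ _ [set lp_single p1 v | v in K] (fun=> e)) dh.
have H : \forall n \near \oo, forall y,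
    [set lp_single p1 v | v in K] y -> `|h n y| <= e.
  by apply: filterS (h0 K Kc e e0) => n hK _ [v Kv <-]; exact: hK.
move=> /(_ H); apply: filterS => n dK v Kv; apply: dK; by exists v.
Qed.

(** Property (K) is applied to the coordinate functionals, and its weights are reused on the
    functionals of the whole sum. The Mackey limit is also the weak* limit, hence zero. *)
Lemma property_K_block (i : J) (h : nat -> dual E) :
  property_K (X i) -> pointwise_null h ->
  exists2 d, block_of d h & mackey_null i d.
Proof.
move=> HK h0.
have f0 : exists g : dual (X i),
    (fun n => dual_single i (h n)) @ \oo --> (g : weak_star (X i)).
  exists 0; apply/weak_star_cvgP => v; rewrite dual0E.
  by have /pointwise_nullP := h0; exact.
have [y [S [a [a0 a1 Slt yE]]] [g yg]] := HK _ f0.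
pose d k := \sum_(n <- S k) a n *: h n.
have dh : block_of d h by apply: block_of_convex_block; exists S, a; split.
have ydE k v : y k v = d k (lp_single p1 v).
  by rewrite yE !dual_sumE; apply: eq_bigr => n _; rewrite !dualZE.
have g0 v : g v = 0.
  have /weak_star_cvgP/(_ v) yv := mackey_weak_star yg.
  have /pointwise_nullP/(_ (lp_single p1 v)) dv := pointwise_null_block dh h0.
  rewrite -(cvg_lim (@Rhausdorff R) yv); apply: (cvg_lim (@Rhausdorff R)).
  by under eq_fun do rewrite ydE.
exists d => // K Kc e e0.
have /mackey_cvgP/(_ K Kc e e0) := yg; apply: filterS => n yn v Kv.
by have := yn v Kv; rewrite g0 sub0r normrN ydE => /ltW.
Qed.

Lemma property_K_blocks (s : seq J) (h : nat -> dual E) :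
  (forall i, property_K (X i)) -> pointwise_null h ->
  exists2 d, block_of d h & forall i, i \in s -> mackey_null i d.
Proof.
move=> HK h0; elim: s => [|i s [d dh ds]].
  by exists h => //; exact: block_of_refl.
have [d' d'd d'i] := property_K_block (HK i) (pointwise_null_block dh h0).
exists d' => [|j]; first exact: block_of_trans dh.
rewrite inE => /predU1P[->//|js].
exact: mackey_null_block d'd (ds j js).
Qed.

End coordinates.

(** * The diagonal block and the conclusion *)

Section assembly.
Context {R : realType} {I : Type} (X : I -> completeNormedModType R) (p : R).
Hypotheses (p1 : 1 <= p) (hp : 1 < p).

Local Notation E := (lp_sum X p1).
Local Notation J := {classic I}.

Lemma supp_le_restrict (A : set J) (h : dual E) (c : R) (x : E) :
  0 <= c -> supp_le A h c -> `|h (lp_restrict A x)| <= c * `|x|.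
Proof.
move=> c0 hA; apply: le_trans (hA _ (@supported_restrict _ _ _ _ _ _ _)) _.
exact: ler_wpM2l c0 _ _ (lp_restrict_norm A x).
Qed.

(** One finite set from [hull_small_tails] serves every tail, so picking a functional in the hull of
    each tail gives a block. The bound on [h] is only eventual, whence the shift by [N]. *)
Lemma block_small_tails (h : nat -> dual E) (C e : R) :
  0 < C -> (\forall n \near \oo, forall x, `|h n x| <= C * `|x|) -> 0 < e ->
  exists d (F : {fset J}), block_of d h /\ forall n, supp_le (~` [set` F]) (d n) e.
Proof.
move=> C0 [N _ hC] e0; pose h' n := h (n + N)%N.
have h'C n x : `|h' n x| <= C * `|x| by apply: hC; rewrite /= leq_addl.
have [F HF] := hull_small_tails hp C0 h'C e0.
have /choice[d dP] := HF; exists d, F; split=> [|n]; last by have [] := dP n.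
apply: block_of_trans (block_of_shift h N); apply: block_of_hull => k.
by have [] := dP k.
Qed.

Lemma fset_mackey_null (s : seq J) (d : nat -> dual E) (K : set E) (e : R) :
  weakly_compact K -> 0 < e -> (forall i, i \in s -> mackey_null i d) ->
  \forall n \near \oo, forall x, K x ->
    \sum_(i <- s) `|d n (lp_single p1 (x i))| <= e.
Proof.
move=> Kc; elim: s e => [|i s IH] e e0 ds.
  by apply: filterE => n x _; rewrite big_nil ltW.
have e20 : 0 < e / 2 by rewrite divr_gt0.
have is_ : i \in i :: s by rewrite inE eqxx.
have := ds i is_ _ (weakly_compact_coord Kc) _ e20.
have := IH _ e20 (fun j js => ds j (mem_behead (s := i :: s) js)).
apply: filterS2 => n sn dn x Kx; rewrite big_cons [leRHS]splitr.
by apply: lerD; [apply: dn; exists x|exact: sn].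
Qed.

Lemma mackey_null_of_tails (d : nat -> dual E) :
  (forall k, exists F : {fset J},
    (\forall n \near \oo, supp_le (~` [set` F]) (d n) k.+1%:R^-1) /\
    forall i, i \in F -> mackey_null i d) ->
  forall K, weakly_compact K -> forall e : R, 0 < e ->
  \forall n \near \oo, forall x, K x -> `|d n x| <= e.
Proof.
move=> dP K Kc e e0; have e20 : 0 < e / 2 by rewrite divr_gt0.
have [M M0 MK] := weakly_bounded_uniform (fun f => weakly_compact_bounded f Kc).
(* Chosen so that the coordinates outside [F] contribute at most [e / 2]. *)
pose k := Num.bound (M / (e / 2)).
have ck : M * k.+1%:R^-1 <= e / 2.
  rewrite ler_pdivrMr ?ltr0n// mulrC -ler_pdivrMr//.
  rewrite (le_trans (ltW (archi_boundP _))) ?ler_nat//.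
  by rewrite divr_ge0// ltW.
have [F [dF Fnull]] := dP k.
have := fset_mackey_null Kc e20 Fnull; apply: filterS2 dF => n dF nF x Kx.
rewrite (lp_restrictC [set` F] x) linearD [leRHS]splitr.
apply: le_trans (ler_normD _ _) _; apply: lerD.
  rewrite lp_restrict_fset linear_sum.
  by apply: le_trans (ler_norm_sum _ _ _) _; exact: nF.
have k0 : 0 < k.+1%:R^-1 :> R by rewrite invr_gt0 ltr0n.
have dnle y : `|d n (lp_restrict (~` [set` F]) y)| <= k.+1%:R^-1 * `|y|.
  exact: supp_le_restrict (ltW k0) dF.
(* The uniform bound on [K] requires a small norm on the whole space, so [d n] is composed with the
   restriction. *)
have dnd : ((d n \o lp_restrict (~` [set` F])) : E -> R^o) \in is_dual (X := E).
  apply: (@is_dual_bounded _ _ _ k.+1%:R^-1) => [a y z|y]; last exact: dnle.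
  by rewrite /= lp_restrict_linear linearP.
exact: le_trans (MK (Dual dnd) _ k0 dnle _ Kx) ck.
Qed.

(** The diagonal argument is run on [P]. Tails come first because [F] depends on them; passing then
    to blocks that are Mackey-null on [F] keeps the tail bound by convexity. *)
Lemma block_mackey_null (u : nat -> dual E) (C : R) :
  (forall i, property_K (X i)) -> pointwise_null u ->
  0 < C -> (forall n x, `|u n x| <= C * `|x|) ->
  exists2 d, block_of d u & forall K, weakly_compact K ->
    forall e : R, 0 < e -> \forall n \near \oo, forall x, K x -> `|d n x| <= e.
Proof.
move=> HK u0 C0 uC.
pose P k (d : nat -> dual E) := exists F : {fset J},
  (\forall n \near \oo, supp_le (~` [set` F]) (d n) k.+1%:R^-1) /\
  forall i, i \in F -> mackey_null i d.
have [k h d [F [hF hi]] dh|k h hu|d du dP] := @block_of_diag _ _ P u.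
- exists F; split; last by move=> i iF; exact: mackey_null_block dh (hi i iF).
  exact: (block_of_near (@is_convex_supp_le _ _ _ _ p1 _ _) dh hF).
- have hC : \forall n \near \oo, forall x, setT x -> `|h n x| <= C * `|x|.
    apply: (block_of_near (@is_convex_dual_le _ _ setT _) hu).
    by apply: filterE => n x _.
  have hC' : \forall n \near \oo, forall x, `|h n x| <= C * `|x|.
    by apply: filterS hC => n hn x; exact: hn.
  have k0 : 0 < k.+1%:R^-1 :> R by rewrite invr_gt0 ltr0n.
  have [h' [F [h'h h'F]]] := block_small_tails C0 hC' k0.
  have h'0 := pointwise_null_block (block_of_trans h'h hu) u0.
  have [d dh' dF] := property_K_blocks F HK h'0.
  exists d; first exact: block_of_trans h'h.
  exists F; split => //.
  exact: (block_of_near (@is_convex_supp_le _ _ _ _ p1 _ _) dh' (filterE _ h'F)).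
exists d => //; exact: mackey_null_of_tails.
Qed.

Lemma property_K_lp_sum : (forall i, property_K (X i)) -> property_K E.
Proof.
move=> HK f [g /weak_star_cvgP fg]; pose u n := f n - g.
have uE n x : u n x = f n x - g x by rewrite dualBE.
have ucvg x : u n x @[n --> \oo] --> (0 : R^o).
  under eq_fun do rewrite uE; rewrite -(subrr (g x)).
  by apply: cvgB; [exact: fg|exact: cvg_cst].
have [C C0 uC] : exists2 C : R, 0 < C & forall n x, `|u n x| <= C * `|x|.
  by apply: weak_star_bounded => x; apply/cvg_ex; exists 0.
have u0 : pointwise_null u by apply/pointwise_nullP.
have [d du dnull] := block_mackey_null HK u0 C0 uC.
have [phi phi_ge [S [a [a0 a1 Slt dE]]]] := convex_block_of du.
(* The weights of a block sum to 1, so adding [g] back turns a convex block of [f n - g] into one of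
   [f n]. *)
exists (fun k => d (phi k) + g).
  exists S, a; split => // k; have /= -> := dE k.
  rewrite -[X in _ + X]scale1r -(a1 k) scaler_suml -big_split/=.
  by apply: eq_bigr => n _; rewrite -scalerDr subrK.
exists g; apply/mackey_cvgP => K Kc e e0.
(* The bound in [dnull] is non-strict; halving [e] makes it strict. *)
have e20 : 0 < e / 2 by rewrite divr_gt0.
have [N _ dN] := dnull K Kc _ e20; exists N => // k /= Nk x Kx.
have gdE : (d (phi k) + g : dual E) x = d (phi k) x + g x by exact: dualDE.
rewrite -[X in `|g x - X|]/((d (phi k) + g : dual E) x) gdE.
rewrite opprD addrCA subrr addr0 normrN.
apply: le_lt_trans (dN (phi k) (leq_trans Nk (phi_ge k)) x Kx) _.
by rewrite ltr_pdivrMr// ltr_pMr// ltr1n.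
Qed.

End assembly.

Theorem theorem2p15 (R : realType) (I : Type)
    (X : I -> completeNormedModType R)
    (HK : forall i, property_K (X i))
    (p : R) (hp : 1 < p) :
  property_K (lp_sum X (ltW hp)).
Proof. exact: property_K_lp_sum. Qed.
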